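(* Let $\Bbbk$ be a field, let $R=\Bbbk[x_1,\dots,x_n]$, and let $I=(f_0,f_1,\dots,f_k)\subseteq R$ be an ideal equigenerated in degree $r$. Then there exists a positive integer $D$ such that for all integers $d>D$, and for all homological indices $i\ge 0$ and all integers $j$, $$\beta_{i,\,j+rd}(I^d)\neq 0\iff \beta_{i,\,j+rD}(I^D)\neq 0.$$
   Context: $R=\Bbbk[x_1,\dots,x_n]$ is given the standard grading $\deg x_i=1$. The ideal $I=(f_0,\dots,f_k)$ is equigenerated in degree $r$ if each generator $f_i$ is homogeneous of degree $r$. For a homogeneous ideal $J\subseteq R$, the graded Betti numbers are $\beta_{i,j}(J)=\dim_{\Bbbk}\operatorname{Tor}^R_i(\Bbbk,J)_j$, where $\Bbbk=R/(x_1,\dots,x_n)$; these are computed for $J$ itself as an $R$-module (not for $R/J$). *)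

(* Defs.v *)
From HB Require Import structures.
From Stdlib Require Import ClassicalEpsilon.
From mathcomp Require Import all_boot all_order all_algebra.
From mathcomp.multinomials Require Import mpoly.

Set Implicit Arguments.
Unset Strict Implicit.
Unset Printing Implicit Defensive.

Import GRing.Theory.
Local Open Scope ring_scope.

Section Ideals.
Context {R : comNzRingType}.
Implicit Types I J : R -> Prop.

Definition ideal_gen (m : nat) (f : 'I_m -> R) : R -> Prop :=
  fun p => exists c : 'I_m -> R, p = \sum_(l < m) c l * f l.

Definition ideal_mul I J : R -> Prop :=
  fun p => exists (m : nat) (a b : 'I_m -> R),
    [/\ forall l, I (a l), forall l, J (b l) & p = \sum_(l < m) a l * b l].

Fixpoint ideal_exp I (d : nat) : R -> Prop :=
  if d is d'.+1 then ideal_mul I (ideal_exp I d') else fun=> True.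

End Ideals.

(* Homogeneity in an arbitrary integer degree: only 0 has negative degree. *)
Definition zhomog {K : fieldType} {n : nat} (e : int) (p : {mpoly K[n]}) : bool :=
  if e is Posz m then p \is m.-homog else p == 0.

(* [has_dim_quot Z B b]: the vector space Z / B has dimension b, witnessed by
   vectors e_l in Z whose classes form a basis.                              *)
Definition has_dim_quot {K : fieldType} {V : lmodType K} (Z B : V -> Prop)
    (b : nat) : Prop :=
  exists e : 'I_b -> V, (forall l, Z (e l)) /\
    forall z, Z z ->
      exists! c : {ffun 'I_b -> K}, B (z - \sum_(l < b) c l *: e l).

(* A matrix D over R, as a map M^A -> M^B for M = R or any ideal M of R.     *)
Definition free_map {R : comNzRingType} {A B : finType} (D : A -> B -> R)
    (v : {ffun A -> R}) : {ffun B -> R} :=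
  [ffun b => \sum_a v a * D a b].

(* A graded free resolution ... -> P_1 -> P_0 -> k -> 0 of the residue field
   k = R/(x_1, ..., x_n) of R = k[x_1, ..., x_n].  The module P_i is free on
   the finite set [basis P i], whose element b sits in degree [bdeg b].  The
   augmentation P_0 -> k sends b to [aug b]; since the image of p in R/(x) is
   its constant term, it sends v to the sum of the (v b)(0) * aug b.         *)
Record residue_resolution (K : fieldType) (n : nat) := ResidueResolution {
  basis : nat -> finType;
  bdeg : forall i, basis i -> int;
  dif : forall i, basis i.+1 -> basis i -> {mpoly K[n]};
  aug : basis 0 -> K;
  dif_homog : forall i (a : basis i.+1) (b : basis i),
    zhomog (bdeg a - bdeg b) (dif a b);
  aug_homog : forall b : basis 0, aug b != 0 -> bdeg b = 0;
  aug_surj : exists b : basis 0, aug b != 0;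
  exact_aug : forall v : {ffun basis 0 -> {mpoly K[n]}},
    \sum_b (v b)@_0%MM * aug b = 0 <-> exists w, v = free_map (@dif 0) w;
  exact_dif : forall i (v : {ffun basis i.+1 -> {mpoly K[n]}}),
    free_map (@dif i) v = 0 <-> exists w, v = free_map (@dif i.+1) w
}.

Section Tor.
Context {K : fieldType} {n : nat} (P : residue_resolution K n).
Context (J : {mpoly K[n]} -> Prop).

(* P_i (x) J is the direct sum of the shifts J(- bdeg b), b in [basis P i];
   this is its component of degree j.                                        *)
Definition tor_chain (i : nat) (j : int)
    (v : {ffun basis P i -> {mpoly K[n]}}) : Prop :=
  forall b, J (v b) /\ zhomog (j - bdeg b) (v b).

Definition tor_cycle (i : nat) (j : int) :
    {ffun basis P i -> {mpoly K[n]}} -> Prop :=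
  match i with
  | 0 => fun v => tor_chain j v
  | i'.+1 => fun v => tor_chain j v /\ free_map (@dif _ _ P i') v = 0
  end.

Definition tor_boundary (i : nat) (j : int)
    (v : {ffun basis P i -> {mpoly K[n]}}) : Prop :=
  exists2 w, tor_chain j w & v = free_map (@dif _ _ P i) w.

(* dim_k Tor_i(k, J)_j = b, Tor being the homology of P (x) J. *)
Definition has_tor_dim (i : nat) (j : int) (b : nat) : Prop :=
  has_dim_quot (@tor_cycle i j) (@tor_boundary i j) b.

End Tor.

(* The Koszul complex, with basis e_S, S a set of i variables, in homological
   degree i, and e_S |-> sum over x in S of +/- x e_(S \ x).                 *)
Section Koszul.
Context (K : fieldType) (n : nat).
Implicit Types (S T : {set 'I_n}) (x y z : 'I_n) (m : 'X_{1..n}).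
Local Notation R := {mpoly K[n]}.

Definition ksign x T : K := (-1) ^+ #|[set y in T | (y < x)%N]|.

Definition koszul_dif S T : R :=
  \sum_(x | (x \notin T) && (x |: T == S)) ksign x T *: 'X_x.

Definition koszul_basis (i : nat) : finType := {S : {set 'I_n} | #|S| == i}.

Let kd (v : {set 'I_n} -> R) T : R :=
  \sum_(x | x \notin T) ksign x T *: ('X_x * v (x |: T)).

Let ext i (v : {ffun koszul_basis i -> R}) S : R := oapp v 0 (insub S).

Let kmap i := @free_map R (koszul_basis i.+1) (koszul_basis i)
  (fun a b => koszul_dif (val a) (val b)).

Let ext_val i (v : {ffun koszul_basis i -> R}) s : ext v (val s) = v s.
Proof. by rewrite /ext valK. Qed.

Let ext_out i (v : {ffun koszul_basis i -> R}) S : #|S| != i -> ext v S = 0.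
Proof. by move=> h; rewrite /ext insubN. Qed.

Let kmapE i (v : {ffun koszul_basis i.+1 -> R}) b :
  kmap v b = kd (ext v) (val b).
Proof.
rewrite ffunE /kd.
transitivity (\sum_a \sum_(x | x \notin val b)
   (if x |: val b == val a then v a * (ksign x (val b) *: 'X_x) else 0)).
  apply: eq_bigr => a _; rewrite /koszul_dif mulr_sumr.
  by rewrite big_mkcondr.
rewrite exchange_big /=; apply: eq_bigr => x xb.
have cx : #|x |: val b| == i.+1 by rewrite cardsU1 xb (eqP (valP b)).
pose s : koszul_basis i.+1 := Sub (x |: val b) cx.
rewrite -[x |: val b]/(val s) ext_val (bigD1 s) //= eqxx big1 ?addr0.
  by rewrite -scalerAr mulrC.
by move=> a ne; case: eqP => // E; case/eqP: ne; apply/val_inj/esym.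
Qed.

Let ksignU x y T : x != y -> y \notin T ->
  ksign x (y |: T) = (-1) ^+ (y < x)%N * ksign x T.
Proof.
move=> xy yT; rewrite /ksign -exprD; congr (_ ^+ _).
case: (ltnP y x) => h /=.
  have -> : [set z in y |: T | (z < x)%N] = y |: [set z in T | (z < x)%N].
    by apply/setP => z; rewrite !inE; case: eqP => [->|] //=; rewrite h.
  by rewrite cardsU1 !inE (negbTE yT).
rewrite (_ : [set z in y |: T | _] = [set z in T | (z < x)%N]) //.
apply/setP => z; rewrite !inE; case: eqP => [->|] //=.
by rewrite (negbTE yT) ltnNge h.
Qed.

Let kd_kd v T : kd (kd v) T = 0.
Proof.
pose F x y : R := ksign x T *: (ksign y (x |: T) *: ('X_x * ('X_y * v (y |: (x |: T))))).
have FN x y : x \notin T -> y \notin T -> (x < y)%N -> F y x = - F x y.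
  move=> xT yT lt; rewrite /F.
  have ne : x != y by rewrite neq_ltn lt.
  rewrite !scalerA (setUCA [set x]) (mulrCA 'X_x) -scaleNr; congr (_ *: _).
  rewrite (ksignU ne yT) (ksignU (x := y)) ?xT // 1?eq_sym //.
  by rewrite lt ltnNge (ltnW lt) /= expr1 expr0 mul1r mulN1r mulrN opprK mulrC.
transitivity (\sum_(x | x \notin T) \sum_(y | (y \notin T) && (y != x)) F x y).
  apply: eq_bigr => x xT; rewrite /kd mulr_sumr scaler_sumr.
  apply: eq_big => [y|y _]; first by rewrite !inE negb_or andbC.
  by rewrite /F -scalerAr.
pose G x y := if (x < y)%N then F x y else 0.
transitivity (\sum_(x | x \notin T) \sum_(y | y \notin T) (G x y - G y x)).
  apply: eq_bigr => x xT; rewrite big_mkcondr; apply: eq_bigr => y yT.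
  rewrite /G -val_eqE; case: ltngtP => h /=; rewrite ?subr0 ?sub0r //.
  by rewrite FN.
under eq_bigr do rewrite sumrB.
by rewrite sumrB [X in _ - X]exchange_big subrr.
Qed.

Let ismin y m S : bool := ((y \in S) || (m y != 0%N)) &&
  [forall z : 'I_n, (z < y)%N ==> (z \notin S) && (m z == 0%N)].

Let ismin_uniq y z m S : ismin y m S -> ismin z m S -> y = z.
Proof.
move=> /andP[y1 /forallP y2] /andP[z1 /forallP z2]; apply: val_inj.
case: (ltngtP y z) => // h.
  by move: (implyP (z2 y) h) y1 => /andP[/negbTE-> /eqP->].
by move: (implyP (y2 z) h) z1 => /andP[/negbTE-> /eqP->].
Qed.

Let ismin_ex m S : (m != 0%MM) || (S != set0) -> exists y, ismin y m S.
Proof.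
move=> h.
have [y0 hy0] : exists y, (y \in S) || (m y != 0%N).
  case/orP: h => [m0|/set0Pn[y yS]]; last by exists y; rewrite yS.
  case: (pickP (fun y => m y != 0%N)) => [y hy|h]; first by exists y; rewrite hy orbT.
  by case/eqP: m0; apply/mnmP => y; rewrite mnm0E; apply/eqP/negbFE/h.
case: (@arg_minnP _ y0 (fun y => (y \in S) || (m y != 0%N)) val hy0) => y hy miny.
exists y; rewrite /ismin hy; apply/forallP => z; apply/implyP => lt.
have := contra (miny z); rewrite -ltnNge => /(_ lt).
by rewrite negb_or negbK.
Qed.

(* A contracting homotopy: divide a monomial of multidegree a by its smallest
   variable and wedge with the corresponding basis vector.                   *)
Let kq y S (p : R) : R :=
  \sum_(m <- msupp p | (m y != 0%N) && ismin y (m - U_(y))%MM S)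
     p@_m *: 'X_[m - U_(y)].

Let kh (v : {set 'I_n} -> R) S : R := \sum_(y in S) kq y S (v (S :\ y)).

Let subU m x : m x != 0%N -> (m - U_(x) + U_(x))%MM = m.
Proof. by move=> h; rewrite submK // lep1mP. Qed.

Let kqE y S p m : (kq y S p)@_m = if ismin y m S then p@_(m + U_(y)) else 0.
Proof.
rewrite /kq raddf_sum /=.
under eq_bigr => m' _ do rewrite mcoeffZ mcoeffX.
have e m' : (m' y != 0%N) -> ((m' - U_(y))%MM == m) = (m' == (m + U_(y))%MM).
  move=> h; apply/eqP/eqP => [<-|->]; first by rewrite subU.
  by rewrite addmK.
rewrite big_mkcond /=.
transitivity (\sum_(m' <- msupp p | m' == (m + U_(y))%MM)
   (if ismin y m S then p@_m' else 0)).
  rewrite [RHS]big_mkcond; apply: eq_bigr => m' _.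
  case: (boolP (m' y != 0%N)) => h /=.
    rewrite -e //; case: eqP => [->|_]; first by rewrite mulr1.
    by rewrite mulr0 if_same.
  case: eqP => // E; move: h.
  by rewrite E mnmDE mnm1E eqxx addn1.
case: ifP => _; last by rewrite big1.
have [h|h] := boolP ((m + U_(y))%MM \in msupp p).
  by rewrite -big_filter filter_pred1_uniq ?msupp_uniq // big_seq1.
rewrite big1_seq ?(memN_msupp_eq0 h) // => m' /andP[/eqP-> h'].
by rewrite h' in h.
Qed.

Let khE v S m y : ismin y m S ->
  (kh v S)@_m = if y \in S then (v (S :\ y))@_(m + U_(y)) else 0.
Proof.
move=> my; rewrite /kh raddf_sum /=.
under eq_bigr => z _ do rewrite kqE.
case: ifP => yS.
  rewrite (bigD1 y) //= my big1 ?addr0 // => z /andP[_ zy].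
  by case: ifP => // /(ismin_uniq my) e; rewrite e eqxx in zy.
apply: big1 => z zS; case: ifP => // /(ismin_uniq my) e.
by rewrite e zS in yS.
Qed.

Let coefXM x p m :
  ('X_x * p : R)@_m = if m x != 0%N then p@_(m - U_(x)) else 0.
Proof.
rewrite mulrC; case: ifP => h; first by rewrite -[in LHS](subU h) addmC mcoeffMX.
apply: memN_msupp_eq0; rewrite (perm_mem (msuppMX p _)).
apply: contraFN h => /mapP[m' _ ->].
by rewrite mnmDE mnm1E eqxx.
Qed.

Let kdE v T m : (kd v T)@_m =
  \sum_(x | (x \notin T) && (m x != 0%N))
    ksign x T * (v (x |: T))@_(m - U_(x)).
Proof.
rewrite /kd raddf_sum big_mkcondr /=; apply: eq_bigr => x _.
by rewrite mcoeffZ coefXM; case: ifP => // _; rewrite mulr0.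
Qed.

Let ksign_min y m S : ismin y m S -> ksign y S = 1.
Proof.
move=> /andP[_ /forallP h]; rewrite /ksign.
rewrite (_ : [set z in S | (z < y)%N] = set0) ?cards0 //.
apply/setP => z; rewrite !inE; apply/negP => /andP[zS lt].
by move: (implyP (h z) lt); rewrite zS.
Qed.

Let ismin_shift y x m T : x \notin T -> m x != 0%N ->
  ismin y m T -> ismin y (m - U_(x))%MM (x |: T).
Proof.
have e z : x \notin T -> m x != 0%N ->
    (z \in x |: T) || ((m - U_(x))%MM z != 0%N) = (z \in T) || (m z != 0%N).
  move=> xT mx; rewrite !inE mnmBE mnm1E eq_sym.
  by case: eqP => [<-|_] /=; rewrite ?mx ?orbT ?subn0.
move=> xT mx /andP[h1 /forallP h2]; rewrite /ismin e // h1.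
apply/forallP => z; apply/implyP => lt; move: (implyP (h2 z) lt).
by rewrite -[_ && _]negbK negb_and negbK -e // negb_or negbK.
Qed.

Let kd_exact v T : (forall S, kd v S = 0) ->
  (T = set0 -> (v T)@_0%MM = 0) -> v T = kd (kh v) T.
Proof.
move=> kv0 h0; apply/mpolyP => m.
case: (boolP ((m != 0%MM) || (T != set0))); last first.
  rewrite negb_or !negbK => /andP[/eqP-> /eqP T0].
  rewrite h0 // kdE big1 // => x /andP[_].
  by rewrite mnm0E eqxx.
case/ismin_ex => y my; rewrite kdE.
under eq_bigr => x /andP[xT mx] do rewrite (khE v (ismin_shift xT mx my)).
have [yT|yT] := boolP (y \in T); last first.
  have my0 : m y != 0%N by case/andP: my; rewrite (negbTE yT).
  rewrite (bigD1 y) ?yT //= big1 ?addr0.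
    rewrite !inE eqxx /= subU // (ksign_min my) mul1r setU1K //.
  move=> x /andP[_ xy]; rewrite !inE eq_sym (negbTE xy) (negbTE yT) /=.
  by rewrite mulr0.
have := congr1 (mcoeff (m + U_(y))%MM) (kv0 (T :\ y)).
rewrite mcoeff0 kdE (bigD1 y) /=; last first.
  by rewrite !inE eqxx mnmDE mnm1E eqxx addn1.
rewrite addmK setD1K // (_ : ksign y _ = 1); last first.
  rewrite /ksign (_ : [set _ in _ | _] = set0) ?cards0 //.
  apply/setP => z; rewrite !inE; apply/negP => /andP[/andP[_ zT] lt].
  by case/andP: my => _ /forallP/(_ z)/implyP/(_ lt); rewrite zT.
rewrite mul1r => /eqP; rewrite addr_eq0 => /eqP->; rewrite -sumrN.
apply: eq_big => [x|x].
  rewrite !inE negb_and negbK mnmDE mnm1E eq_sym.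
  by case: eqP => [<-|_] /=; rewrite ?yT ?andbF // addn0 andbT.
move=> /andP[/andP[xT mx] xy].
rewrite !inE (eq_sym y) (negbTE xy) yT /=.
have xT' : x \notin T by move: xT; rewrite !inE xy.
have mx' : m x != 0%N.
  by move: mx; rewrite mnmDE mnm1E (eq_sym y) (negbTE xy) addn0.
have yx : (y < x)%N.
  rewrite ltnNge leq_eqVlt negb_or (val_eqE x y) xy /=; apply/negP => lt.
  by case/andP: my => _ /forallP/(_ x)/implyP/(_ lt); rewrite (negbTE mx') andbF.
have -> : ksign x T = - ksign x (T :\ y).
  by rewrite -{1}(setD1K yT) ksignU ?inE ?eqxx // yx expr1 mulN1r.
have -> : (x |: T) :\ y = x |: T :\ y.
  apply/setP => z; rewrite !inE.
  by case: (eqVneq z x) => [->|] //=; rewrite xy.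
rewrite mulNr; congr (- (_ * (_)@_ _)).
apply/mnmP => z; rewrite !(mnmDE, mnmBE, mnm1E).
case: (eqVneq x z) => [<-|_] /=; last by rewrite !subn0.
by rewrite (eq_sym y) (negbTE xy) !addn0.
Qed.

Let ext_restr i (w : {set 'I_n} -> R) (b : koszul_basis i) x :
  x \notin val b ->
  ext [ffun a : koszul_basis i.+1 => w (val a)] (x |: val b) = w (x |: val b).
Proof.
move=> xb.
have cx : #|x |: val b| == i.+1 by rewrite cardsU1 xb (eqP (valP b)).
pose s : koszul_basis i.+1 := Sub (x |: val b) cx.
by rewrite -[x |: val b]/(val s) ext_val ffunE.
Qed.

Let kd_ext i (v : {ffun koszul_basis i.+1 -> R}) :
  kmap v = 0 -> forall S, kd (ext v) S = 0.
Proof.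
move=> v0 S; case: (eqVneq #|S| i) => [cS|cS].
  pose s : koszul_basis i := Sub S (introT eqP cS).
  by rewrite -[S]/(val s) -kmapE v0 ffunE.
rewrite /kd big1 // => x xS; rewrite ext_out ?mulr0 ?scaler0 //.
by rewrite cardsU1 xS.
Qed.

Let kd_restr i (w : {set 'I_n} -> R) (b : koszul_basis i) :
  kmap [ffun a : koszul_basis i.+1 => w (val a)] b = kd w (val b).
Proof.
by rewrite kmapE /kd; apply: eq_bigr => x xb; rewrite ext_restr.
Qed.

Let card_basis0 (b : koszul_basis 0) : val b = set0.
Proof. by apply/eqP; rewrite -cards_eq0; exact: valP b. Qed.

Let sum_basis0 (F : koszul_basis 0 -> K) b : \sum_a F a = F b.
Proof.
rewrite (bigD1 b) //= big1 ?addr0 // => a /eqP[].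
by apply: val_inj; rewrite !card_basis0.
Qed.

Let empty0 : koszul_basis 0 := Sub set0 (introT eqP (cards0 _)).

Lemma koszul_dif_homog i (a : koszul_basis i.+1) (b : koszul_basis i) :
  zhomog (i.+1%:Z - i%:Z) (koszul_dif (val a) (val b)).
Proof.
rewrite intS addrK /=; apply: rpred_sum => x _; apply: rpredZ.
by rewrite dhomogX; apply/eqP; exact: mdeg1.
Qed.

Lemma koszul_aug_surj : exists b : koszul_basis 0, (1 : K) != 0.
Proof. by exists empty0; rewrite oner_eq0. Qed.

Lemma koszul_exact_aug (v : {ffun koszul_basis 0 -> R}) :
  \sum_b (v b)@_0%MM * (1 : K) = 0 <-> exists w, v = kmap w.
Proof.
rewrite (sum_basis0 _ empty0) mulr1; split => [v0|[w ->]]; last first.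
  rewrite kmapE kdE big1 // => x /andP[_].
  by rewrite mnm0E eqxx.
exists [ffun a : koszul_basis 1 => kh (ext v) (val a)].
apply/ffunP => b; rewrite kd_restr -kd_exact ?ext_val // => [S|_].
  rewrite /kd big1 // => x xS; rewrite ext_out ?mulr0 ?scaler0 //.
  by rewrite cardsU1 xS.
by rewrite (_ : b = empty0) //; apply: val_inj; rewrite card_basis0.
Qed.

Lemma koszul_exact_dif i (v : {ffun koszul_basis i.+1 -> R}) :
  kmap v = 0 <-> exists w, v = kmap w.
Proof.
split => [v0|[w ->]].
  exists [ffun a : koszul_basis i.+2 => kh (ext v) (val a)].
  apply/ffunP => b; rewrite kd_restr -kd_exact ?ext_val //; first exact: kd_ext.
  by move=> b0; have := valP b; rewrite b0 cards0.
apply/ffunP => b; rewrite kmapE [RHS]ffunE -[RHS](kd_kd (ext w) (val b)).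
apply: eq_bigr => x xb; congr (_ *: (_ * _)).
have cx : #|x |: val b| == i.+1 by rewrite cardsU1 xb (eqP (valP b)).
pose s : koszul_basis i.+1 := Sub (x |: val b) cx.
by rewrite -[x |: val b]/(val s) ext_val kmapE.
Qed.

Definition koszul_resolution : residue_resolution K n :=
  @ResidueResolution K n koszul_basis (fun i _ => i%:Z)
    (fun i a b => koszul_dif (val a) (val b)) (fun=> 1)
    koszul_dif_homog (fun _ _ => erefl) koszul_aug_surj
    koszul_exact_aug koszul_exact_dif.

End Koszul.

(* The graded Betti number dim_k Tor_i(k, J)_j of J, with Tor computed from
   the Koszul resolution of k.  For an ideal J the dimension is finite and
   [epsilon] returns its unique value.                                       *)
Definition betti {K : fieldType} {n : nat} (J : {mpoly K[n]} -> Prop)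
    (i : nat) (j : int) : nat :=
  epsilon (inhabits 0%N) (has_tor_dim (koszul_resolution K n) J i j).

(* Main.v *)
Require Import Defs.
From HB Require Import structures.
From mathcomp Require Import all_boot all_order all_algebra zify.
From mathcomp.multinomials Require Import mpoly.
From Stdlib Require Import Classical ClassicalEpsilon.

(** Write I for the ideal generated by the f_l and T_i(d, j) for the degree
    j + rd part of Tor_i(K, I^d).  Multiplication by f_l maps T_i(d, j) to
    T_i(d+1, j), so for fixed i the sum of all T_i(d, j) is a module over
    K[T_1, ..., T_s], with T_l acting as f_l and raising d by one while fixing
    j.  This module is finitely generated.  Hence T_i(d, j) is nonzero for
    finitely many j only, and once d exceeds the degrees of the generators,
    T_i(d+1, j) is spanned by the products f_l T_i(d, j); so beyond that point
    T_i(d, j) <> 0 is a decreasing condition on d ([rees_tor_generation]), and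
    a decreasing condition is eventually constant ([eventually_const]).  Only
    i <= n matters because the Koszul complex has length n, so finitely many
    conditions are at stake and one D serves them all.

    Finite generation comes from the Noetherian property of
    S = K[x_1, ..., x_n, T_1, ..., T_s].  The ring S maps onto the Rees
    algebra, T_l going to f_l; a form of bidegree (e, d) goes to an element of
    I^d of degree e + rd, and every homogeneous element of I^d lifts
    ([rees_surj_homog]).  So the Koszul cycles with coefficients in the powers
    of I lift to a bigraded submodule of a free S-module of finite rank.
    Dickson's lemma and division with remainder by leading terms give finitely
    many bihomogeneous generators ([graded_noetherian]).  Passing from S to
    K[T_1, ..., T_s] uses that each x_i kills the homology
    ([koszul_mulX_boundary]).

    Betti numbers are dimensions of cycles modulo boundaries, which lie in a
    finite-dimensional space; so a Betti number is nonzero exactly when some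
    cycle is not a boundary ([betti_neq0]), and the whole argument runs on
    such cycles. *)

Set Implicit Arguments.
Unset Strict Implicit.
Unset Printing Implicit Defensive.

Import Order.TTheory GRing.Theory.
Local Open Scope ring_scope.

(** * Dickson's lemma and graded submodules of free modules *)

(** Induction on the number M of exponents.  Take a finite L that is dominating
    for the first M exponents, and let B bound the last exponent on L.  Then L
    handles every vector whose last exponent is at least B, and for each of the
    finitely many smaller values of the last exponent the induction hypothesis
    applies again. *)
Lemma dickson (T : eqType) (w : nat -> T -> nat) (M : nat) (E : T -> Prop) :
  exists2 L : seq T, forall u, u \in L -> E u &
    forall v, E v -> exists2 u, u \in L & forall i, (i < M)%N -> (w i u <= w i v)%N.
Proof.
elim: M E => [|M IH] E.
  have [[u Eu]|nE] := classic (exists u, E u).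
    by exists [:: u] => [v|v _]; [rewrite inE => /eqP -> | exists u; rewrite ?inE].
  by exists [::] => // v Ev; case: nE; exists v.
have [L LE domL] := IH E.
pose B := \max_(u <- L) w M u.
have [L' L'E domL'] : exists2 L' : seq T, forall u, u \in L' -> E u &
    forall v, E v -> (w M v < B)%N -> exists2 u, u \in L' &
      forall i, (i < M.+1)%N -> (w i u <= w i v)%N.
  elim: B => [|B [L' L'E domL']]; first by exists [::].
  have [L'' L''E domL''] := IH (fun u => E u /\ w M u = B).
  exists (L'' ++ L') => [u|v Ev].
    by rewrite mem_cat => /orP[/L''E[]|/L'E].
  rewrite ltnS leq_eqVlt => /orP[/eqP wv|wv].
    have [u uL uv] := domL'' v (conj Ev wv); exists u; first by rewrite mem_cat uL.
    move=> i; rewrite ltnS leq_eqVlt => /orP[/eqP ->|/uv //].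
    by have [_ ->] := L''E u uL; rewrite wv.
  have [u uL uv] := domL' v Ev wv; exists u => //.
  by rewrite mem_cat uL orbT.
exists (L ++ L') => [u|v Ev]; first by rewrite mem_cat => /orP[/LE|/L'E].
have [lt|le] := ltnP (w M v) B.
  by have [u uL uv] := domL' v Ev lt; exists u; rewrite ?mem_cat ?uL ?orbT.
have [u uL uv] := domL v Ev; exists u; first by rewrite mem_cat uL.
move=> i; rewrite ltnS leq_eqVlt => /orP[/eqP ->|/uv //].
exact: leq_trans (leq_bigmax_seq _ uL isT) le.
Qed.

Definition subspace (K : fieldType) (V : lmodType K) (Q : V -> Prop) :=
  Q 0 /\ forall (c : K) u v, Q u -> Q v -> Q (c *: u + v).

Definition pscale (K : fieldType) (M : nat) (A : finType) (p : {mpoly K[M]})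
  (v : {ffun A -> {mpoly K[M]}}) := [ffun a => p * v a].

Lemma mlead_cancel (K : fieldType) M (p q : {mpoly K[M]}) :
  p != 0 -> q != 0 -> mlead q = mlead p ->
  let s := p - (mleadc p / mleadc q) *: q in
  s = 0 \/ (mlead s < mlead p)%O.
Proof.
move=> p0 q0 qp s; have [->|s0] := eqVneq s 0; [by left | right].
rewrite lt_neqAle; apply/andP; split.
  apply: contra_neq s0 => e; apply/eqP; rewrite -mleadc_eq0 e /s.
  by rewrite mcoeffB mcoeffZ qp divfK ?subrr // -qp mleadc_eq0.
apply: le_trans (mleadB_le _ _) _.
rewrite mleadZ; first by rewrite qp joinxx.
by rewrite mulf_neq0 ?invr_eq0 ?mleadc_eq0.
Qed.

(** [N g] is the degree g component of a graded submodule of a free module of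
    finite rank over a polynomial ring whose monomial m has degree [wt m].  The
    submodule is given by its homogeneous elements only. *)
Section GradedNoether.
Context (K : fieldType) (M : nat) (A : finType) (G : nmodType).
Local Notation V := {ffun A -> {mpoly K[M]}}.
Context (wt : 'X_{1..M} -> G) (N : G -> V -> Prop).
Hypothesis wtD : forall m m', wt (m + m')%MM = wt m + wt m'.
Hypothesis N_sub : forall g, subspace (N g).
Hypothesis N_mul : forall g m v, N g v -> N (wt m + g) (pscale 'X_[m] v).
Hypothesis N_hom : forall g v a m, N g v -> m \in msupp (v a) -> wt m = g.

Let N_gen (L : seq (G * V)) g v := forall Q : V -> Prop, subspace Q ->
  (forall u m, u \in L -> wt m + u.1 = g -> Q (pscale 'X_[m] u.2)) -> Q v.

(* Induction on the set of coordinates where the vectors may be nonzero.  For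
   the first such coordinate a, Dickson's lemma gives finitely many vectors
   whose leading monomials at a divide all the others; reducing by these
   vectors kills the coordinate a, one leading monomial after another. *)
Let graded_noetherian_supp (s : seq A) :
  exists2 L : seq (G * V), forall u, u \in L -> N u.1 u.2 &
    forall g v, N g v -> (forall a, a \notin s -> v a = 0) -> N_gen L g v.
Proof.
elim: s => [|a s [L LN Lgen]].
  exists [::] => // g v _ v0 Q [Q0 _] _.
  by rewrite (_ : v = 0) //; apply/ffunP => a; rewrite v0 // ffunE.
pose vanish (v : V) := forall b, b \notin a :: s -> v b = 0.
pose E (u : G * V) := [/\ N u.1 u.2, vanish u.2 & u.2 a != 0].
(* The default 0 concerns indices i >= M only, which Dickson's lemma ignores. *)
pose w i (u : G * V) := oapp (mlead (u.2 a)) 0%N (insub i : option 'I_M).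
have [L' L'E domL'] := dickson w M E.
exists (L' ++ L) => [u|g v].
  by rewrite mem_cat => /orP[/L'E[]|/LN].
suff gen m : N g v -> vanish v -> mlead (v a) = m -> N_gen (L' ++ L) g v.
  by move=> Nv v0; exact: gen.
elim/(ltmwf (n := M)): m v => m IH v Nv v0 vm.
have small (v' : V) : N g v' -> vanish v' ->
    v' a = 0 \/ (mlead (v' a) < m)%O -> N_gen (L' ++ L) g v'.
  move=> Nv' v'0 [va0|lt]; last exact: (IH _ lt).
  move=> Q Qs Qg; apply: (Lgen g v' Nv' _ Q Qs) => [b bs|u m' uL]; last first.
    by apply: Qg; rewrite mem_cat uL orbT.
  by have [->//|ba] := eqVneq b a; apply: v'0; rewrite inE negb_or ba.
have [va0|va0] := eqVneq (v a) 0; first by apply: small => //; left.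
have [|u uL uv] := domL' (g, v); first by split.
have [Nu u0 ua0] := L'E u uL.
have dvd : (mlead (u.2 a) <= m)%MM.
  by apply/mnm_lepP => i; have := uv i (ltn_ord i); rewrite /w valK /= vm.
pose m' := (m - mlead (u.2 a))%MM.
have wt_m' : wt m' + u.1 = g.
  rewrite -(N_hom Nu (mlead_supp ua0)) -wtD submK //.
  by apply: (N_hom (a := a) Nv); rewrite -vm mlead_supp.
pose z := pscale 'X_[m'] u.2.
pose c := mleadc (v a) / mleadc (z a).
have Nz : N g z by rewrite -wt_m'; exact: N_mul.
have za : z a = 'X_[m'] * u.2 a by rewrite ffunE.
have nX : 'X_[m'] != 0 :> {mpoly K[M]} by rewrite -msupp_eq0 msuppX.
have za0 : z a != 0 by rewrite za mulf_neq0.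
have zm : mlead (z a) = m by rewrite za mleadM // mleadXm submK.
move=> Q Qs Qg; have [_ Qlin] := Qs.
have -> : v = c *: z + (- c *: z + v) by rewrite addrA scaleNr subrr add0r.
apply: (Qlin); first by apply: Qg => //; rewrite mem_cat uL.
have /small : N g (- c *: z + v) by have [_] := N_sub g; apply.
apply=> //.
  by move=> b bs; rewrite !ffunE v0 // u0 // mulr0 scaler0 addr0.
have -> : (- c *: z + v) a = v a - c *: z a by rewrite !ffunE addrC scaleNr.
rewrite -vm; apply: mlead_cancel => //.
by rewrite zm vm.
Qed.

(** Membership of v in the span of the monomial multiples of L that have the
    degree of v is expressed by induction: v satisfies every linear condition Q
    that all these multiples satisfy. *)
Lemma graded_noetherian :
  exists2 L : seq (G * V), forall u, u \in L -> N u.1 u.2 &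
    forall g v, N g v -> forall Q : V -> Prop, subspace Q ->
      (forall u m, u \in L -> wt m + u.1 = g -> Q (pscale 'X_[m] u.2)) -> Q v.
Proof.
have [L LN Lgen] := graded_noetherian_supp (enum A).
exists L => // g v Nv; apply: Lgen => // a.
by rewrite mem_enum.
Qed.

End GradedNoether.

(** * Dimensions of quotients *)

Section DimQuot.
Context (K : fieldType) (V : lmodType K).
Implicit Types (Q Z B : V -> Prop).

Lemma subspaceZ Q c v : subspace Q -> Q v -> Q (c *: v).
Proof. by case=> Q0 Ql Qv; rewrite -[_ *: _]addr0; apply: Ql. Qed.

Lemma subspaceD Q u v : subspace Q -> Q u -> Q v -> Q (u + v).
Proof. by case=> Q0 Ql Qu Qv; rewrite -[u]scale1r; apply: Ql. Qed.

Lemma subspaceB Q u v : subspace Q -> Q u -> Q v -> Q (u - v).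
Proof.
move=> Qs Qu Qv; apply: subspaceD => //.
by rewrite -scaleN1r; apply: subspaceZ.
Qed.

Lemma subspace_sum Q (I : Type) (s : seq I) (P : pred I) (F : I -> V) :
  subspace Q -> (forall i, P i -> Q (F i)) -> Q (\sum_(i <- s | P i) F i).
Proof.
move=> Qs QF; apply: (big_ind Q) => //; first by case: Qs.
by move=> u v; apply: subspaceD.
Qed.

Definition indep_mod Z B b (e : 'I_b -> V) :=
  (forall l, Z (e l)) /\
  forall c : 'I_b -> K, B (\sum_l c l *: e l) -> forall l, c l = 0.

(** The finitely many coordinates [co] are linear and separate the points of Z,
    so they bound the size of a family in Z that is independent modulo B.  A
    family of maximal size is a basis of Z / B: if z were outside its span
    modulo B, adding z would give a larger one. *)
Lemma has_dim_quot_ex Z B (F : finType) (co : F -> V -> K) :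
  subspace Z -> subspace B -> (forall v, B v -> Z v) ->
  (forall x c u v, co x (c *: u + v) = c * co x u + co x v) ->
  (forall v, Z v -> (forall x, co x v = 0) -> v = 0) ->
  exists b, has_dim_quot Z B b.
Proof.
move=> Zs Bs BZ co_lin co_inj.
have co0 x : co x 0 = 0.
  by have := co_lin x (-1) 0 0; rewrite scaler0 addr0 mulN1r addNr.
have co_sum x b (c : 'I_b -> K) (e : 'I_b -> V) :
    co x (\sum_l c l *: e l) = \sum_l c l * co x (e l).
  apply: (big_rec2 (fun u a => co x u = a)) => // l a u _ <-.
  exact: co_lin.
have bound b (e : 'I_b -> V) : indep_mod Z B e -> (b <= #|F|)%N.
  move=> [eZ ind]; rewrite leqNgt; apply/negP => lt.
  pose D := \matrix_(l < b, s < #|F|) co (enum_val s) (e l).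
  have : ~~ row_free D by rewrite -row_leq_rank -ltnNge (leq_ltn_trans (rank_leq_col D)).
  rewrite -kermx_eq0 => /rowV0Pn[y /sub_kermxP yD /negP[]].
  suff y0 l : y 0 l = 0 by apply/eqP/rowP => l; rewrite y0 mxE.
  apply: (ind (y 0)); rewrite (_ : \sum_l _ = 0); first by case: Bs.
  apply: co_inj => [|x].
    by apply: subspace_sum => // l' _; apply: subspaceZ.
  have /rowP/(_ (enum_rank x)) := yD; rewrite !mxE co_sum => yx.
  by rewrite -[RHS]yx; apply: eq_bigr => l' _; rewrite mxE enum_rankK.
have [b [[e [eZ ind]] bmax]] : exists b, (exists e : 'I_b -> V, indep_mod Z B e) /\
    ~ exists e : 'I_b.+1 -> V, indep_mod Z B e.
  apply: NNPP => nmax.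
  have all b : exists e : 'I_b -> V, indep_mod Z B e.
    elim: b => [|b IH].
      by exists (fun=> 0); split=> [l|c _ l]; [case: Zs | case: l].
    by apply: NNPP => nb; apply: nmax; exists b.
  have [e /bound] := all #|F|.+1.
  by rewrite ltnn.
exists b, e; split=> // z Zz.
suff [c Bc] : exists c : {ffun 'I_b -> K}, B (z - \sum_l c l *: e l).
  exists c; split => // c' Bc'; apply/ffunP => l; apply/eqP.
  rewrite -subr_eq0; apply/eqP; move: l; apply: ind.
  have := subspaceB Bs Bc' Bc.
  congr B; rewrite opprB addrC addrA subrK -sumrB.
  by apply: eq_bigr => l _; rewrite scalerBl.
apply: NNPP => nc; apply: bmax.
exists (fun l => if unlift ord0 l is Some l' then e l' else z).
split=> [l|c]; first by case: unliftP.
rewrite big_ord_recl unlift_none.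
under eq_bigr do rewrite liftK.
move=> Bc.
have c0 : c ord0 = 0.
  apply: NNPP => /eqP c0; apply: nc; exists [ffun l => - (c ord0)^-1 * c (lift ord0 l)].
  have := subspaceZ (c ord0)^-1 Bs Bc.
  rewrite scalerDr scalerA mulVf // scale1r scaler_sumr -sumrN.
  congr B; congr (_ + _); apply: eq_bigr => l _.
  by rewrite ffunE scalerA mulNr scaleNr opprK.
have {}ind := ind (fun l => c (lift ord0 l)).
move: Bc; rewrite c0 scale0r add0r => /ind cl l.
by case: (unliftP ord0 l) => [l' ->|->].
Qed.

Lemma has_dim_quot0P Z B b : subspace B -> has_dim_quot Z B b ->
  b <> 0%N <-> exists2 z, Z z & ~ B z.
Proof.
move=> Bs [e [eZ eB]]; split.
  case: b e eZ eB => [//|b] e eZ eB _; exists (e ord0) => // Be.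
  have [c [_ cu]] := eB _ (eZ ord0).
  have c0 : c = [ffun=> 0].
    apply: cu; rewrite big1 ?subr0 // => l _.
    by rewrite ffunE scale0r.
  have c1 : c = [ffun l => (l == ord0)%:R].
    apply: cu; rewrite (bigD1 ord0) //= ffunE eqxx scale1r big1.
      by rewrite addr0 subrr; case: Bs.
    by move=> l /negbTE l0; rewrite ffunE l0 scale0r.
  move/ffunP: c1 => /(_ ord0)/eqP.
  by rewrite c0 !ffunE eqxx eq_sym oner_eq0.
case=> z Zz nBz b0; subst b; case: nBz.
by have [c [Bz _]] := eB _ Zz; rewrite big_ord0 subr0 in Bz.
Qed.

End DimQuot.

(** * Homology with coefficients in an ideal *)

Definition is_ideal (R : comNzRingType) (J : R -> Prop) :=
  [/\ J 0, forall p q, J p -> J q -> J (p + q) & forall c p, J p -> J (c * p)].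

Lemma ideal_sum (R : comNzRingType) (J : R -> Prop) (I : Type) (s : seq I)
  (P : pred I) (F : I -> R) :
  is_ideal J -> (forall i, P i -> J (F i)) -> J (\sum_(i <- s | P i) F i).
Proof. by case=> J0 JD JM JF; apply: (big_ind J). Qed.

Section Zhomog.
Context (K : fieldType) (n : nat).
Implicit Types (p q : {mpoly K[n]}) (z : int).

Lemma zhomog0 z : zhomog z (0 : {mpoly K[n]}).
Proof. by case: z => e /=; [exact: rpred0 | exact: eqxx]. Qed.

Lemma zhomogP z (c : K) p q : zhomog z p -> zhomog z q -> zhomog z (c *: p + q).
Proof.
case: z => e /=; first by move=> hp hq; rewrite rpredD ?rpredZ.
by move=> /eqP -> /eqP ->; rewrite scaler0 addr0.
Qed.

Lemma zhomogD z p q : zhomog z p -> zhomog z q -> zhomog z (p + q).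
Proof. by move=> hp hq; rewrite -[p]scale1r zhomogP. Qed.

Lemma zhomogM z1 z2 p q : zhomog z1 p -> zhomog z2 q -> zhomog (z1 + z2) (p * q).
Proof.
case: z1 => e1 /=; last by move=> /eqP -> _; rewrite mul0r zhomog0.
case: z2 => e2 /=; last by move=> _ /eqP ->; rewrite mulr0 zhomog0.
exact: dhomogM.
Qed.

End Zhomog.

Section FreeMap.
Context (K : fieldType) (n : nat) (A B : finType) (D : A -> B -> {mpoly K[n]}).

Lemma free_map_lin (c : K) v w :
  free_map D (c *: v + w) = c *: free_map D v + free_map D w.
Proof.
apply/ffunP => b; rewrite !ffunE scaler_sumr -big_split /=.
by apply: eq_bigr => a _; rewrite !ffunE mulrDl scalerAl.
Qed.

Lemma free_map0 : free_map D 0 = 0.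
Proof.
by apply/ffunP => b; rewrite !ffunE big1 // => a _; rewrite ffunE mul0r.
Qed.

Lemma free_map_pscale p v : free_map D (pscale p v) = pscale p (free_map D v).
Proof.
apply/ffunP => b; rewrite !ffunE mulr_sumr.
by apply: eq_bigr => a _; rewrite ffunE mulrA.
Qed.

End FreeMap.

Section PScale.
Context (K : fieldType) (n : nat) (A : finType).
Implicit Types (p : {mpoly K[n]}) (v w : {ffun A -> {mpoly K[n]}}).

Lemma pscale0 p : pscale p (0 : {ffun A -> {mpoly K[n]}}) = 0.
Proof. by apply/ffunP => a; rewrite !ffunE mulr0. Qed.

Lemma pscaleA p q v : pscale p (pscale q v) = pscale (p * q) v.
Proof. by apply/ffunP => a; rewrite !ffunE mulrA. Qed.

End PScale.

Section TorTheory.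
Context (K : fieldType) (n : nat) (P : residue_resolution K n).
Local Notation R := {mpoly K[n]}.
Implicit Types (J : R -> Prop).

Lemma tor_chain_sub J i j : is_ideal J -> subspace (@tor_chain K n P J i j).
Proof.
case=> J0 JD JM; split=> [b|c u v uc vc b]; rewrite !ffunE.
  by split; last exact: zhomog0.
have [[Ju hu] [Jv hv]] := (uc b, vc b).
by split; [rewrite -mul_mpolyC; apply: JD => //; apply: JM | apply: zhomogP].
Qed.

Lemma tor_cycle_chain J i j v : @tor_cycle K n P J i j v -> tor_chain J j v.
Proof. by case: i v => [|i] v //= []. Qed.

Lemma tor_cycle_sub J i j : is_ideal J -> subspace (@tor_cycle K n P J i j).
Proof.
move=> Ji; case: i => [|i]; first exact: tor_chain_sub.
have [C0 Cl] := tor_chain_sub i.+1 j Ji.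
split=> [|c u v [uc u0] [vc v0]] /=; first by split; rewrite ?free_map0.
by split; [exact: Cl | rewrite free_map_lin u0 v0 scaler0 addr0].
Qed.

Lemma tor_boundary_sub J i j :
  is_ideal J -> subspace (@tor_boundary K n P J i j).
Proof.
move=> Ji; have [C0 Cl] := tor_chain_sub i.+1 j Ji.
split=> [|c _ _ [u uc ->] [v vc ->]]; first by exists 0; rewrite ?free_map0.
by exists (c *: u + v); [exact: Cl | rewrite free_map_lin].
Qed.

Lemma tor_boundary_cycle J i j v :
  is_ideal J -> @tor_boundary K n P J i j v -> @tor_cycle K n P J i j v.
Proof.
move=> Ji [w wc -> {v}]; have [_ _ JM] := Ji.
have ch : tor_chain J j (free_map (@dif _ _ P i) w).
  move=> b; rewrite ffunE; split.
    by apply: ideal_sum => // a _; rewrite mulrC; apply: JM; have [] := wc a.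
  apply: (big_ind (zhomog (j - bdeg b))).
  - exact: zhomog0.
  - exact: zhomogD.
  - move=> a _; have [_ hw] := wc a.
    by have := zhomogM hw (dif_homog a b); rewrite addrA subrK.
case: i w wc ch => [//|i] w wc ch; split=> //.
by apply/exact_dif; exists w.
Qed.

Lemma has_tor_dim_ex J i j : is_ideal J -> exists b, has_tor_dim P J i j b.
Proof.
move=> Ji.
(* All components of a chain have degree below bd, so that their coefficients
   at monomials of degree below bd determine the chain. *)
pose bd := (\max_(b : Defs.basis P i) `|(j - bdeg b)%R|%N).+1.
pose co (x : Defs.basis P i * 'X_{1..n < bd}) (v : {ffun Defs.basis P i -> R}) : K :=
  (v x.1)@_(x.2).
apply: (@has_dim_quot_ex K _ _ _ _ co).
- exact: tor_cycle_sub.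
- exact: tor_boundary_sub.
- by move=> v; apply: tor_boundary_cycle.
- by move=> x c u v; rewrite /co !ffunE mcoeffD mcoeffZ.
move=> v /tor_cycle_chain vc v0; apply/ffunP => b; rewrite ffunE.
have [_] := vc b; rewrite /zhomog; case E: (j - bdeg b) => [e|e] hv; last exact/eqP.
apply/mpolyP => m; rewrite mcoeff0.
have [me|me] := eqVneq (mdeg m) e; last exact: (dhomog_nemf_coeff hv me).
have lt : (mdeg m < bd)%N.
  by rewrite me ltnS; apply: (leq_trans _ (leq_bigmax b)); rewrite E.
exact: (v0 (b, BMultinom lt)).
Qed.

Definition tor_neq0 J i j :=
  exists2 v, @tor_cycle K n P J i j v & ~ tor_boundary J j v.

(** In the next three lemmas p is a form with p J contained in J', as for
    p = x_i and J' = J, or p = f_l and (J, J') = (I^d, I^(d+1)): multiplication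
    by p then induces a map from Tor_i(K, J) to Tor_i(K, J') of degree deg p. *)
Lemma tor_chain_pscale J J' i j e p v :
  p \is e.-homog -> (forall q, J q -> J' (p * q)) ->
  tor_chain J j v -> @tor_chain K n P J' i (e%:Z + j) (pscale p v).
Proof.
move=> hp JJ' vc b; have [Jv hv] := vc b; rewrite ffunE; split; first exact: JJ'.
by rewrite -addrA; apply: zhomogM.
Qed.

Lemma tor_cycle_pscale J J' i j e p v :
  p \is e.-homog -> (forall q, J q -> J' (p * q)) ->
  tor_cycle J j v -> @tor_cycle K n P J' i (e%:Z + j) (pscale p v).
Proof.
move=> hp JJ'; case: i v => [|i] v; first exact: tor_chain_pscale.
case=> vc v0; split; first exact: (tor_chain_pscale hp JJ').
by rewrite free_map_pscale v0 pscale0.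
Qed.

Lemma tor_boundary_pscale J J' i j e p v :
  p \is e.-homog -> (forall q, J q -> J' (p * q)) ->
  tor_boundary J j v -> @tor_boundary K n P J' i (e%:Z + j) (pscale p v).
Proof.
move=> hp JJ' [w wc ->]; exists (pscale p w); last by rewrite free_map_pscale.
exact: (tor_chain_pscale hp JJ').
Qed.

End TorTheory.

Lemma betti_neq0 (K : fieldType) (n : nat) (J : {mpoly K[n]} -> Prop) i j :
  is_ideal J -> betti J i j <> 0%N <-> tor_neq0 (koszul_resolution K n) J i j.
Proof.
move=> Ji; apply: has_dim_quot0P; first exact: tor_boundary_sub.
exact: (epsilon_spec (inhabits 0%N) _ (has_tor_dim_ex _ i j Ji)).
Qed.

(** * The variables kill Koszul homology *)

Section KoszulHomotopy.
Context (K : fieldType) (n : nat).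
Local Notation R := {mpoly K[n]}.
Local Notation P := (koszul_resolution K n).
Implicit Types (S T : {set 'I_n}) (x y : 'I_n).

(** Extending by 0 to all subsets lets sets be manipulated without carrying
    their cardinality. *)
Definition koszul_ext i (v : {ffun koszul_basis n i -> R}) S : R :=
  oapp v 0 (insub S).

Lemma koszul_extE i (v : {ffun koszul_basis n i -> R}) s :
  koszul_ext v (val s) = v s.
Proof. by rewrite /koszul_ext valK. Qed.

Lemma koszul_mapE i (v : {ffun koszul_basis n i.+1 -> R}) (b : koszul_basis n i) :
  free_map (@dif _ _ P i) v b =
  \sum_(x | x \notin val b) ksign K x (val b) *: ('X_x * koszul_ext v (x |: val b)).
Proof.
rewrite ffunE /= /koszul_dif.
under eq_bigr do rewrite mulr_sumr big_mkcondr /=.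
rewrite exchange_big /=; apply: eq_bigr => x xb.
have cx : #|x |: val b| == i.+1 by rewrite cardsU1 xb (eqP (valP b)).
rewrite -big_mkcond (big_pred1 (Sub (x |: val b) cx)) => [|a] /=.
  rewrite -[x |: val b]/(val (Sub (x |: val b) cx : koszul_basis n i.+1)).
  by rewrite koszul_extE -scalerAr mulrC.
by rewrite eq_sym -val_eqE.
Qed.

Lemma ksignM x T : ksign K x T * ksign K x T = 1.
Proof. by rewrite /ksign -exprD addnn -mul2n exprM sqrrN !expr1n. Qed.

Lemma ksignU1 x y T : y \notin T ->
  ksign K x (y |: T) = (-1) ^+ (y < x)%N * ksign K x T.
Proof.
move=> yT; rewrite /ksign -exprD; congr (_ ^+ _).
have -> : [set z in y |: T | (z < x)%N] =
  (if (y < x)%N then [set y] else set0) :|: [set z in T | (z < x)%N].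
  apply/setP => z; rewrite !inE; case: ifP => yx; rewrite !inE.
    by case: eqP => [->|] //=.
  by case: eqP => [->|] //=; rewrite yx andbF.
by case: (y < x)%N; rewrite ?set0U // cardsU1 inE (negbTE yT).
Qed.

(** Contracting two distinct variables in the two possible orders gives
    opposite signs. *)
Lemma ksign_swap x y T : x != y -> x \notin T -> y \notin T ->
  ksign K y (x |: T) * ksign K x (y |: T) = - (ksign K y T * ksign K x T).
Proof.
move=> xy xT yT; rewrite !ksignU1 // mulrACA -exprD.
by move: xy; rewrite -val_eqE /=; case: ltngtP => //= _ _; rewrite expr1 mulN1r.
Qed.

(** The exterior product e_x v, up to the sign convention of the Koszul
    differential: [ksign K x T] is the sign with which e_T occurs in the
    differential of e_(x |: T). *)
Definition koszul_wedge i x (v : {ffun koszul_basis n i -> R}) :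
    {ffun koszul_basis n i.+1 -> R} :=
  [ffun S : koszul_basis n i.+1 => if x \in val S then
     ksign K x (val S :\ x) *: koszul_ext v (val S :\ x) else 0].

Lemma koszul_wedge_ext i x (v : {ffun koszul_basis n i -> R}) S : #|S| = i.+1 ->
  koszul_ext (koszul_wedge x v) S =
    if x \in S then ksign K x (S :\ x) *: koszul_ext v (S :\ x) else 0.
Proof.
move=> /eqP cS; rewrite -[S]/(val (Sub S cS : koszul_basis n i.+1)).
by rewrite koszul_extE ffunE.
Qed.

(** Multiplication by e_x is a homotopy between multiplication by x and 0: in
    general d (e_x v) + e_x d v = x v, and here d v = 0.  At a set b without x
    only the variable x contributes to d (e_x v).  At a set b with x, the other
    variables contribute, up to sign, the terms of d v at b minus x other than
    the one of x, so that d v = 0 turns their sum into x v at b. *)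
Lemma koszul_homotopy J i j x (v : {ffun koszul_basis n i -> R}) :
  tor_cycle (P := P) J j v ->
  free_map (@dif _ _ P i) (koszul_wedge x v) = pscale 'X_x v.
Proof.
move=> vc; apply/ffunP => b; rewrite koszul_mapE ffunE.
have cU y : y \notin val b -> #|y |: val b| = i.+1.
  by move=> yb; rewrite cardsU1 yb (eqP (valP b)).
under eq_bigr => y yb do rewrite koszul_wedge_ext ?cU //.
have [xb|xb] := boolP (x \in val b); last first.
  rewrite (bigD1 x) //= setU11 setU1K // big1 ?addr0 => [|y /andP[yb yx]].
    by rewrite koszul_extE -scalerAr scalerA ksignM scale1r.
  by rewrite !inE eq_sym (negbTE yx) (negbTE xb) mulr0 scaler0.
case: i v vc b cU xb => [|i] v vc b cU xb.
  by have := cards_eq0 (val b); rewrite (valP b) => /esym/eqP b0; rewrite b0 inE in xb.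
have cT : #|val b :\ x| == i.
  by have := cardsD1 x (val b); rewrite xb (eqP (valP b)) add1n => -[<-].
have xT : x \notin val b :\ x by rewrite !inE eqxx.
case: vc => _ /ffunP/(_ (Sub (val b :\ x) cT)).
rewrite koszul_mapE ffunE /= (bigD1 x) //= setD1K // koszul_extE.
move=> /(congr1 (fun p => ksign K x (val b :\ x) *: p)).
rewrite scaler0 scalerDr scalerA ksignM scale1r => /eqP.
rewrite addr_eq0 => /eqP ->; rewrite scaler_sumr -sumrN.
apply: eq_big => [y|y yb]; first by rewrite !inE; case: eqP => [->|]; rewrite ?xb ?andbT.
have xy : x != y by apply: contraNneq yb => <-.
have yT : y \notin val b :\ x by rewrite !inE (negbTE yb) andbF.
rewrite setU1r // -scalerAr !scalerA -scaleNr.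
have -> : (y |: val b) :\ x = y |: (val b :\ x).
  apply/setP => z; rewrite !inE.
  by case: (eqVneq z x) => [->|] //=; rewrite (negbTE xy).
rewrite [ksign K x _ * _]mulrC -ksign_swap // setD1K //.
Qed.

Lemma koszul_mulX_boundary J i j x (v : {ffun koszul_basis n i -> R}) :
  is_ideal J -> tor_cycle (P := P) J j v ->
  tor_boundary (P := P) J (1%:Z + j) (pscale 'X_x v).
Proof.
move=> [J0 JD JM] vc; exists (koszul_wedge x v); last by rewrite (koszul_homotopy _ vc).
move/tor_cycle_chain in vc.
have ext_ch S : J (koszul_ext v S) /\ zhomog (j - i%:Z) (koszul_ext v S).
  rewrite /koszul_ext; case: insubP => [s _ _|_] /=; first exact: vc.
  by split; last exact: zhomog0.
move=> b; have [Je he] := ext_ch (val b :\ x).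
rewrite ffunE [bdeg _]intS opprD addrACA subrr add0r.
case: ifP => _; last by split; last exact: zhomog0.
split; first by rewrite -mul_mpolyC; exact: JM.
by rewrite -[_ *: _]addr0; apply: zhomogP; last exact: zhomog0.
Qed.

End KoszulHomotopy.

(** * Powers of an ideal *)

Section Ideals.
Context (R : comNzRingType).
Implicit Types (I J : R -> Prop).

Lemma ideal_gen_ideal m (f : 'I_m -> R) : is_ideal (ideal_gen f).
Proof.
split=> [|_ _ [c ->] [c' ->]|a _ [c ->]].
- by exists (fun=> 0); rewrite big1 // => l _; rewrite mul0r.
- exists (fun l => c l + c' l); rewrite -big_split.
  by apply: eq_bigr => l _; rewrite mulrDl.
exists (fun l => a * c l); rewrite mulr_sumr.
by apply: eq_bigr => l _; rewrite mulrA.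
Qed.

Lemma ideal_gen_mem m (f : 'I_m -> R) l : ideal_gen f (f l).
Proof.
exists (fun l' => (l' == l)%:R); rewrite (bigD1 l) //= eqxx mul1r.
by rewrite big1 ?addr0 // => l' /negbTE ->; rewrite mul0r.
Qed.

Lemma ideal_mul_mem I J p q : I p -> J q -> ideal_mul I J (p * q).
Proof.
by exists 1%N, (fun=> p), (fun=> q); split=> //; rewrite big_ord1.
Qed.

Lemma ideal_mul_ideal I J : is_ideal I -> is_ideal (ideal_mul I J).
Proof.
move=> [I0 ID IM]; split=> [|_ _ [m [a [b [Ia Jb ->]]]] [m' [a' [b' [Ia' Jb' ->]]]]|].
- by exists 0%N, (fun=> 0), (fun=> 0); split=> [[]|[]|] //; rewrite big_ord0.
- pose cat (g : 'I_m -> R) (g' : 'I_m' -> R) l :=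
    match split l with inl s => g s | inr s => g' s end.
  exists (m + m')%N, (cat a a'), (cat b b'); split=> [l|l|].
  + by rewrite /cat; case: (split l).
  + by rewrite /cat; case: (split l).
  rewrite big_split_ord /cat; congr (_ + _); apply: eq_bigr => l _.
    by rewrite (unsplitK (inl l)).
  by rewrite (unsplitK (inr l)).
move=> c _ [m [a [b [Ia Jb ->]]]]; exists m, (fun l => c * a l), b.
split=> [l||] //; first exact: IM.
by rewrite mulr_sumr; apply: eq_bigr => l _; rewrite mulrA.
Qed.

Lemma ideal_exp_ideal I d : is_ideal I -> is_ideal (ideal_exp I d).
Proof. by case: d => [|d] Ii /=; [split | exact: ideal_mul_ideal]. Qed.

Lemma ideal_expD I a b p q : is_ideal I ->
  ideal_exp I a p -> ideal_exp I b q -> ideal_exp I (a + b) (p * q).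
Proof.
move=> Ii; elim: a p => [|a IH] p /=.
  by move=> _ Iq; have [_ _] := ideal_exp_ideal b Ii; apply.
move=> [m [x [y [Ix Iy ->]]]] Iq; exists m, x, (fun l => y l * q).
split=> [l|l|] //; first exact: IH.
by rewrite mulr_suml; apply: eq_bigr => l _; rewrite mulrA.
Qed.

Lemma ideal_exp1 I p : I p -> ideal_exp I 1 p.
Proof. by move=> Ip; rewrite -[p]mulr1; apply: ideal_mul_mem. Qed.

Lemma ideal_expX I p d : is_ideal I -> I p -> ideal_exp I d (p ^+ d).
Proof.
move=> Ii Ip; elim: d => [//|d IH]; rewrite exprS -add1n.
by apply: ideal_expD => //; apply: ideal_exp1.
Qed.

End Ideals.

(** * The presentation of the Rees algebra *)

Section Bidegree.
Context (n s : nat).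
Implicit Types m : 'X_{1..n + s}.

Definition xdeg m := (\sum_(x < n) m (lshift s x))%N.
Definition tdeg m := (\sum_(l < s) m (rshift n l))%N.

Lemma xdeg0 : xdeg 0%MM = 0%N.
Proof. by rewrite /xdeg big1 // => x _; rewrite mnm0E. Qed.
Lemma xdegD m m' : xdeg (m + m')%MM = (xdeg m + xdeg m')%N.
Proof. by rewrite /xdeg -big_split; apply: eq_bigr => x _; rewrite mnmDE. Qed.
Lemma tdeg0 : tdeg 0%MM = 0%N.
Proof. by rewrite /tdeg big1 // => x _; rewrite mnm0E. Qed.
Lemma tdegD m m' : tdeg (m + m')%MM = (tdeg m + tdeg m')%N.
Proof. by rewrite /tdeg -big_split; apply: eq_bigr => x _; rewrite mnmDE. Qed.

End Bidegree.

#[hnf] HB.instance Definition _ n s :=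
  isMeasure.Build (n + s) (@xdeg n s) (xdeg0 n s) (@xdegD n s).
#[hnf] HB.instance Definition _ n s :=
  isMeasure.Build (n + s) (@tdeg n s) (tdeg0 n s) (@tdegD n s).

Lemma pihomog_dhomog (K : fieldType) N (mf mf' : measure N) a b (p : {mpoly K[N]}) :
  p \is b.-homog for mf' -> pihomog mf a p \is b.-homog for mf'.
Proof.
move=> hp; rewrite /pihomog big_seq_cond; apply: rpred_sum => m /andP[mp _].
by apply: rpredZ; rewrite dhomogX; apply/eqP; exact: (dhomog_mf hp).
Qed.

Section Rees.
Context (K : fieldType) (n r k : nat) (f : 'I_k -> {mpoly K[n]}).
Hypothesis f_homog : forall l, f l \is r.-homog.
Local Notation R := {mpoly K[n]}.
Local Notation S := {mpoly K[n + k]}.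
Local Notation I := (ideal_gen f).

(** The first n variables of S go to those of R and the last k to the
    generators f.  The Rees parameter t, which would separate the powers of the
    ideal, is replaced by the T-degree on the side of S. *)
Definition rees_tuple : (n + k).-tuple R :=
  [tuple match split i with inl x => 'X_x | inr l => f l end | i < n + k].

Definition rees_map (p : S) : R := p \mPo rees_tuple.

Lemma rees_map_lin c p q : rees_map (c *: p + q) = c *: rees_map p + rees_map q.
Proof. by rewrite /rees_map comp_mpolyD comp_mpolyZ. Qed.

Lemma rees_mapM p q : rees_map (p * q) = rees_map p * rees_map q.
Proof. exact: rmorphM. Qed.

Lemma rees_map0 : rees_map 0 = 0. Proof. exact: comp_mpoly0. Qed.

Lemma rees_map_sum (T : Type) (s : seq T) (F : T -> S) :
  rees_map (\sum_(t <- s) F t) = \sum_(t <- s) rees_map (F t).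
Proof. exact: (raddf_sum (comp_mpoly rees_tuple)). Qed.

Lemma rees_mapXl x : rees_map 'X_(lshift k x) = 'X_x.
Proof. by rewrite /rees_map comp_mpolyXU -tnth_nth tnth_mktuple (unsplitK (inl x)). Qed.

Lemma rees_mapXr l : rees_map 'X_(rshift n l) = f l.
Proof. by rewrite /rees_map comp_mpolyXU -tnth_nth tnth_mktuple (unsplitK (inr l)). Qed.

Lemma rees_mapX m : rees_map 'X_[m] =
  (\prod_(x < n) 'X_x ^+ m (lshift k x)) * \prod_(l < k) f l ^+ m (rshift n l).
Proof.
rewrite /rees_map comp_mpolyX big_split_ord; congr (_ * _).
  by apply: eq_bigr => x _; rewrite tnth_mktuple (unsplitK (inl x)).
by apply: eq_bigr => x _; rewrite tnth_mktuple (unsplitK (inr x)).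
Qed.

Lemma rees_map_mem d p :
  p \is d.-homog for (@tdeg n k) -> ideal_exp I d (rees_map p).
Proof.
have Ii := ideal_gen_ideal f; move=> hp.
have Idi := ideal_exp_ideal d Ii; have [_ _ IM] := Idi.
rewrite /rees_map comp_mpolyEX big_seq; apply: ideal_sum => // m mp.
rewrite -mul_mpolyC; apply: (IM); rewrite -/(rees_map _) rees_mapX; apply: IM.
rewrite -(dhomog_mf hp mp) /=.
apply: (big_ind2 (fun p a => ideal_exp I a p)) => [//|p1 a1 p2 a2|l _].
  exact: ideal_expD.
by apply: ideal_expX => //; exact: ideal_gen_mem.
Qed.

Lemma rees_map_homog e d p :
  p \is e.-homog for (@xdeg n k) -> p \is d.-homog for (@tdeg n k) ->
  rees_map p \is (e + r * d).-homog.
Proof.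
move=> hx ht; rewrite /rees_map comp_mpolyEX big_seq; apply: rpred_sum => m mp.
apply: rpredZ; rewrite -/(rees_map _) rees_mapX.
rewrite -(dhomog_mf hx mp) -(dhomog_mf ht mp) /=.
pose H (q : R) b := q \is b.-homog.
apply: dhomogM; last rewrite big_distrr /=.
  apply: (big_ind2 H) => [|p1 a1 p2 a2|x _]; [exact: dhomog1 | exact: dhomogM |].
  rewrite /H -[X in X.-homog]mul1n; apply: dhomogMn.
  by rewrite dhomogX; apply/eqP; exact: mdeg1.
apply: (big_ind2 H) => [|p1 a1 p2 a2|x _]; [exact: dhomog1 | exact: dhomogM |].
exact: dhomogMn.
Qed.

Let rees_img d q := exists2 p, p \is d.-homog for (@tdeg n k) & rees_map p = q.

Let rees_imgD d p q : rees_img d p -> rees_img d q -> rees_img d (p + q).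
Proof.
move=> [p' hp <-] [q' hq <-]; exists (p' + q'); first exact: rpredD.
exact: comp_mpolyD.
Qed.

Let rees_img0 d : rees_img d 0.
Proof. by exists 0; [exact: dhomog0 | exact: rees_map0]. Qed.

Let rees_imgM a b p q : rees_img a p -> rees_img b q -> rees_img (a + b) (p * q).
Proof.
move=> [p' hp <-] [q' hq <-]; exists (p' * q'); first exact: dhomogM.
exact: rees_mapM.
Qed.

Let rees_img_f l : rees_img 1 (f l).
Proof.
exists 'X_(rshift n l); last exact: rees_mapXr.
rewrite dhomogX /= /tdeg (bigD1 l) //= mnm1E eqxx big1 // => l' ne.
by rewrite mnm1E (inj_eq (@rshift_inj _ _)) eq_sym (negbTE ne).
Qed.

Let rees_img_R p : rees_img 0 p.
Proof.
have C c : rees_img 0 c%:MP.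
  exists c%:MP; last exact: comp_mpolyC.
  by rewrite -[c%:MP]mulr1 mul_mpolyC rpredZ // dhomog1.
rewrite [p]mpolyE.
apply: (big_ind (rees_img 0)); [exact: rees_img0 | exact: rees_imgD |].
move=> m _; rewrite -mul_mpolyC; apply: (rees_imgM (a := 0)) => //.
rewrite mpolyXE_id; apply: (big_ind (rees_img 0)); [exact: C | exact: rees_imgM |].
move=> x _; elim: (m x) => [|a IH]; first exact: C.
rewrite exprS; apply: (rees_imgM (a := 0)) => //.
exists 'X_(lshift k x); last exact: rees_mapXl.
rewrite dhomogX /= /tdeg big1 // => l' _.
by rewrite mnm1E eq_lrshift.
Qed.

(** Elements of degree d in T cover R for d = 0 and the f_l for d = 1, and the
    image is multiplicative in d. *)
Lemma rees_surj d q : ideal_exp I d q ->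
  exists2 p, p \is d.-homog for (@tdeg n k) & rees_map p = q.
Proof.
elim: d q => [|d IH] q /=; first by move=> _; exact: rees_img_R.
move=> [m [a [b [Ia Ib ->]]]].
apply: (big_ind (rees_img d.+1)); [exact: rees_img0 | exact: rees_imgD |].
move=> l _; rewrite -add1n; apply: rees_imgM; last exact: IH.
have [c ->] := Ia l.
apply: (big_ind (rees_img 1)); [exact: rees_img0 | exact: rees_imgD |].
by move=> l' _; apply: (rees_imgM (a := 0) (b := 1)).
Qed.

(** Components of a lift in different x-degrees have images in different
    degrees, so the component of x-degree E - rd lifts q by itself. *)
Lemma rees_surj_homog d q E : ideal_exp I d q -> q \is E.-homog ->
  if (r * d <= E)%N then
    exists p, [/\ p \is (E - r * d).-homog for (@xdeg n k),
                  p \is d.-homog for (@tdeg n k) & rees_map p = q]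
  else q = 0.
Proof.
move=> /rees_surj[p hp <-{q}] hq.
(* N bounds the x-degrees that occur in p, and is large enough for the index
   E - r * d to lie below it. *)
pose N := maxn (mmeasure (@xdeg n k) p) E.+1.
have pN := @pihomog_partitionE _ _ (@xdeg n k) N p (leq_maxl _ _).
have hpe e : rees_map (pihomog (@xdeg n k) e p) \is (e + r * d).-homog.
  by apply: rees_map_homog; [exact: pihomogP | exact: pihomog_dhomog].
have qE : rees_map p =
    \sum_(e < N | (e + r * d == E)%N) rees_map (pihomog (@xdeg n k) e p).
  rewrite -{1}(pihomog_dE hq) {1}pN rees_map_sum raddf_sum [RHS]big_mkcond.
  apply: eq_bigr => e _; case: eqP => [<-|ne]; first exact: pihomog_dE.
  by apply: (pihomog_ne0 _ (hpe e)); apply/eqP.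
case: ifP => le; last first.
  rewrite qE big1 // => e /eqP eE; rewrite -eE leq_addl // in le.
exists (pihomog (@xdeg n k) (E - r * d) p); split.
- exact: pihomogP.
- exact: pihomog_dhomog.
have lt : (E - r * d < N)%N by rewrite leq_max orbC ltnS leq_subr.
rewrite qE (big_pred1 (Ordinal lt)) // => e /=.
by rewrite -val_eqE /= -[RHS](eqn_add2r (r * d)) subnK.
Qed.

End Rees.

(** * Generation and stability of the Tor modules *)

Section ReesTor.
Context (K : fieldType) (n r k : nat) (f : 'I_k -> {mpoly K[n]}).
Hypothesis f_homog : forall l, f l \is r.-homog.
Local Notation R := {mpoly K[n]}.
Local Notation S := {mpoly K[n + k]}.
Local Notation P := (koszul_resolution K n).
Local Notation Ipow := (ideal_exp (ideal_gen f)).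

Let Ipow_ideal d : is_ideal (Ipow d).
Proof. by apply: ideal_exp_ideal; apply: ideal_gen_ideal. Qed.

Definition bidegree (m : 'X_{1..n + k}) : nat * nat := (xdeg m, tdeg m).

Lemma bidegree_lshift x : bidegree U_(lshift k x) = (1%N, 0%N).
Proof.
rewrite /bidegree /xdeg /tdeg (bigD1 x) //= mnm1E eqxx big1 => [|y ne].
  by rewrite big1 // => l _; rewrite mnm1E eq_lrshift.
by rewrite mnm1E (inj_eq (@lshift_inj _ _)) eq_sym (negbTE ne).
Qed.

Lemma bidegree_rshift l : bidegree U_(rshift n l) = (0%N, 1%N).
Proof.
rewrite /bidegree /xdeg /tdeg [X in (_, X)](bigD1 l) //= mnm1E eqxx.
rewrite big1 => [|x _]; last by rewrite mnm1E eq_rlshift.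
rewrite big1 // => l' ne.
by rewrite mnm1E (inj_eq (@rshift_inj _ _)) eq_sym (negbTE ne).
Qed.

Definition rees_mapv (A : finType) (v : {ffun A -> S}) : {ffun A -> R} :=
  [ffun a => rees_map f (v a)].

Lemma rees_mapv_lin (A : finType) c (u v : {ffun A -> S}) :
  rees_mapv (c *: u + v) = c *: rees_mapv u + rees_mapv v.
Proof. by apply/ffunP => a; rewrite !ffunE rees_map_lin. Qed.

Lemma rees_mapv_pscale (A : finType) p (v : {ffun A -> S}) :
  rees_mapv (pscale p v) = pscale (rees_map f p) (rees_mapv v).
Proof. by apply/ffunP => a; rewrite !ffunE rees_mapM. Qed.

Lemma rees_mapv0 (A : finType) : rees_mapv (0 : {ffun A -> S}) = 0.
Proof. by apply/ffunP => a; rewrite !ffunE rees_map0. Qed.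

Section FixedIndex.
Variable i : nat.
Local Notation V := {ffun koszul_basis n i -> S}.

(** The degree of the image of a chain whose lift has bidegree g: each basis
    vector in homological degree i has degree i. *)
Definition tdegree (g : nat * nat) : int := i%:Z + g.1%:Z + (r * g.2)%N%:Z.

Definition rees_cycle (g : nat * nat) (v : V) : Prop :=
  (forall a, v a \is g.1.-homog for (@xdeg n k) /\
             v a \is g.2.-homog for (@tdeg n k)) /\
  tor_cycle (P := P) (Ipow g.2) (tdegree g) (rees_mapv v).

Lemma rees_cycle_sub g : subspace (rees_cycle g).
Proof.
have [C0 Cl] := tor_cycle_sub P i (tdegree g) (Ipow_ideal g.2).
split=> [|c u v [hu Cu] [hv Cv]]; (split=> [a|]).
- by rewrite ffunE; split; exact: dhomog0.
- by rewrite rees_mapv0.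
- have [[xu tu] [xv tv]] := (hu a, hv a).
  by rewrite !ffunE; split; apply: rpredD => //; apply: rpredZ.
by rewrite rees_mapv_lin; apply: Cl.
Qed.

Lemma rees_cycle_mul g m v :
  rees_cycle g v -> rees_cycle (bidegree m + g) (pscale 'X_[m] v).
Proof.
have hXx : ('X_[m] : S) \is (xdeg m).-homog for (@xdeg n k) by rewrite dhomogX.
have hXt : ('X_[m] : S) \is (tdeg m).-homog for (@tdeg n k) by rewrite dhomogX.
move=> [hv Cv]; split=> [a|].
  by have [xv tv] := hv a; rewrite ffunE; split; apply: dhomogM.
have -> : tdegree (bidegree m + g) = (xdeg m + r * tdeg m)%N%:Z + tdegree g.
  by rewrite /tdegree /bidegree /=; lia.
rewrite rees_mapv_pscale; apply: tor_cycle_pscale Cv.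
  exact: (rees_map_homog f_homog).
move=> q Iq; apply: ideal_expD => //; first exact: ideal_gen_ideal.
exact: rees_map_mem.
Qed.

(** Chains vanish when j < i, because I^d has no nonzero element of degree
    below rd. *)
Lemma rees_cycle_lift j d v :
  tor_cycle (P := P) (i := i) (Ipow d) (j + (r * d)%N%:Z) v ->
  v = 0 \/ exists e V, [/\ j = i%:Z + e%:Z, rees_cycle (e, d) V & rees_mapv V = v].
Proof.
move=> Cv; have ch := tor_cycle_chain Cv.
case E: (j - i%:Z) => [e|e]; [right | left].
  have lift b : exists p, [/\ p \is e.-homog for (@xdeg n k),
      p \is d.-homog for (@tdeg n k) & rees_map f p = v b].
    have [Iv] := ch b; rewrite [bdeg _]/= -addrAC E => hv.
    have := rees_surj_homog f_homog Iv hv.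
    by rewrite leq_addl addnK.
  have [F hF] := fin_all_exists lift.
  exists e, [ffun b => F b].
  have Fv : rees_mapv [ffun b => F b] = v.
    by apply/ffunP => b; rewrite !ffunE; have [] := hF b.
  have jE : j = i%:Z + e%:Z by rewrite -E addrC subrK.
  split=> //; split=> [b|].
    by rewrite ffunE; have [] := hF b.
  by rewrite Fv /tdegree /= -jE.
apply/ffunP => b; rewrite ffunE; have [Iv] := ch b.
rewrite [bdeg _]/= -addrAC E /zhomog.
case Z: (_ + _) => [z|z]; last by move/eqP.
move/(rees_surj_homog f_homog Iv); case: ifP => // le; exfalso.
by move: Z le; lia.
Qed.

(** A nonzero class in degree d+1 forces a monomial multiple of one of the
    finitely many generators u to be a cycle that is not a boundary.  No x
    divides the monomial, since x kills homology; so u has the same x-degree as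
    the class, which leaves finitely many values of j.  As d+1 exceeds the
    T-degree of u, some T_l divides the monomial, and removing it leaves a
    cycle over I^d, which is not a boundary either. *)
Lemma rees_tor_generation : exists D0 E0, forall d j, (D0 <= d)%N ->
  tor_neq0 P (Ipow d.+1) i (j + (r * d.+1)%N%:Z) ->
  tor_neq0 P (Ipow d) i (j + (r * d)%N%:Z) /\
  exists2 e, (e <= E0)%N & j = i%:Z + e%:Z.
Proof.
have bidegreeD m m' : bidegree (m + m')%MM = bidegree m + bidegree m'
  by rewrite /bidegree xdegD tdegD.
have hom g v a m : rees_cycle g v -> m \in msupp (v a) -> bidegree m = g.
  move=> [hv _] mv; have [xv tv] := hv a.
  case: g xv tv {hv} => e d xv tv.
  by rewrite /bidegree (dhomog_mf xv mv) (dhomog_mf tv mv).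
have [L LN Lgen] := graded_noetherian bidegreeD rees_cycle_sub rees_cycle_mul hom.
exists (\max_(u <- L) u.1.2), (\max_(u <- L) u.1.1) => d j Dd [v Cv nBv].
have BI := tor_boundary_sub P i _ (Ipow_ideal _).
have [v0|[e [w [jE Nw wv]]]] := rees_cycle_lift Cv.
  by case: nBv; rewrite v0; have [] := BI d.+1 (j + (r * d.+1)%N%:Z).
pose B g w := tor_boundary (P := P) (i := i) (Ipow g.2) (tdegree g) (rees_mapv w).
have jdE d' : j + (r * d')%N%:Z = tdegree (e, d') by rewrite jE.
rewrite jdE in nBv *.
have [u [m [uL mE nB]]] : exists u m, [/\ u \in L, bidegree m + u.1 = (e, d.+1) &
    ~ B (e, d.+1) (pscale 'X_[m] u.2)].
  apply: NNPP => none; apply: nBv; rewrite -wv.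
  apply: (Lgen _ _ Nw (B (e, d.+1))) => [|u m uL mE]; last first.
    by apply: NNPP => nB; apply: none; exists u, m.
  have [B0 Bl] := BI d.+1 (tdegree (e, d.+1)).
  rewrite /B; split=> [|c x y Bx By]; first by rewrite rees_mapv0.
  by rewrite rees_mapv_lin; apply: Bl.
have Nu := LN _ uL; rewrite -mE in nB.
have split_m s : m s != 0%N -> exists m', m = (U_(s) + m')%MM.
  by move=> ms; exists (m - U_(s))%MM; rewrite addmC submK // lep1mP.
(* If m = x m', then the multiple by m is x times a cycle, so a boundary. *)
have xm0 : xdeg m = 0%N.
  apply: big1 => x _; apply/eqP/negPn/negP => /split_m[m' mm]; apply: nB.
  rewrite mm mpolyXD -pscaleA bidegreeD bidegree_lshift -addrA.
  have [_] := rees_cycle_mul m' Nu; set g := bidegree m' + u.1 => Cg.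
  rewrite /B rees_mapv_pscale rees_mapXl (_ : tdegree _ = 1%:Z + tdegree g).
    exact: koszul_mulX_boundary.
  by rewrite /tdegree /=; lia.
have [em dm] : u.1.1 = e /\ (tdeg m + u.1.2 = d.+1)%N.
  by move: mE; rewrite /bidegree xm0; case: (u.1) => e' d' [].
have eE : (e <= \max_(u <- L) u.1.1)%N.
  by rewrite -em; exact: (leq_bigmax_seq (F := fun u : nat * nat * V => u.1.1) u uL isT).
split; last by exists e.
have dD : (u.1.2 <= \max_(u <- L) u.1.2)%N.
  exact: (leq_bigmax_seq (F := fun u : nat * nat * V => u.1.2) u uL isT).
have [l /split_m[m' mm]] : exists l, m (rshift n l) != 0%N.
  apply: NNPP => none; have t0 : tdeg m = 0%N; last by move: dm dD Dd; lia.
  apply: big1 => l _; apply/eqP/negPn/negP => ml; apply: none.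
  by exists l.
have Nm' := rees_cycle_mul m' Nu.
have gE : bidegree m' + u.1 = (e, d).
  move: mE; rewrite mm bidegreeD bidegree_rshift -addrA.
  by case: (bidegree m' + u.1) => e' d' [<- [<-]].
rewrite gE in Nm'; rewrite jdE; exists (rees_mapv (pscale 'X_[m'] u.2)).
  by have [] := Nm'.
move=> Bm'; apply: nB; rewrite mE mm mpolyXD -pscaleA.
rewrite /B rees_mapv_pscale rees_mapXr.
rewrite (_ : tdegree (e, d.+1) = r%:Z + tdegree (e, d)); last first.
  by rewrite /tdegree /=; lia.
apply: tor_boundary_pscale Bm' => // q Iq.
by apply: ideal_mul_mem => //; exact: ideal_gen_mem.
Qed.

End FixedIndex.
End ReesTor.

(** A decreasing property of d either holds for all d >= D0, or fails from some
    point on. *)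
Lemma eventually_const (T : finType) (A : T -> nat -> Prop) D0 :
  (forall t d, (D0 <= d)%N -> A t d.+1 -> A t d) ->
  exists2 D, (D0 <= D)%N & forall t d, (D <= d)%N -> A t d <-> A t D.
Proof.
move=> dec.
have /fin_all_exists2[D D0D stab] : forall t, exists2 D, (D0 <= D)%N &
    forall d, (D <= d)%N -> A t d <-> A t D.
  move=> t; have [[D [D0D nA]]|all] := classic (exists D, (D0 <= D)%N /\ ~ A t D).
    exists D => // d /subnK <-; elim: (d - D)%N => [//|a IH].
    split=> // At; case: nA; apply/IH; apply: dec At.
    exact: leq_trans (leq_addl _ _).
  exists D0 => // d D0d; split=> _; apply: NNPP => nA; apply: all.
    by exists D0.
  by exists d.
exists (maxn D0 (\max_t D t)); first exact: leq_maxl.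
move=> t d le; have tD : (D t <= maxn D0 (\max_t D t))%N.
  by apply: leq_trans (leq_maxr _ _); apply: leq_bigmax.
rewrite (stab t d); last exact: leq_trans le.
by rewrite (stab t _ tD).
Qed.

Section ReesTorStable.
Context (K : fieldType) (n r k : nat) (f : 'I_k -> {mpoly K[n]}).
Hypothesis f_homog : forall l, f l \is r.-homog.
Local Notation P := (koszul_resolution K n).
Local Notation Ipow := (ideal_exp (ideal_gen f)).
Local Notation nz i j d := (tor_neq0 P (Ipow d) i (j + (r * d)%N%:Z)).

Lemma rees_tor_stable_index i :
  exists D, forall d j, (D <= d)%N -> nz i j d <-> nz i j D.
Proof.
have [D0 [E0 gen]] := rees_tor_generation f_homog i.
have [|D DD stab] := @eventually_const 'I_E0.+1
    (fun e d => nz i (i%:Z + (e : nat)%:Z) d) D0.+1.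
  by move=> e d Dd /(gen _ _ (ltnW Dd))[].
exists D => d j Dd.
have small d' : (D <= d')%N -> nz i j d' -> exists e : 'I_E0.+1, j = i%:Z + (e : nat)%:Z.
  case: d' => [|d'] Dd'; first by have := leq_trans DD Dd'.
  have /gen h : (D0 <= d')%N by rewrite -ltnS (leq_trans DD).
  by move=> /h[_ [e eE ->]]; exists (Ordinal (eE : e < E0.+1)%N).
split=> h.
  by have [e je] := small d Dd h; rewrite je in h *; apply/(stab e d Dd).
by have [e je] := small D (leqnn D) h; rewrite je in h *; apply/(stab e d Dd).
Qed.

Lemma koszul_tor0 J i j : is_ideal J -> (n < i)%N -> ~ tor_neq0 P J i j.
Proof.
move=> Ji ni [v _ []].
have -> : v = 0; last by have [] := tor_boundary_sub P i j Ji.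
apply/ffunP => b; have := max_card (mem (val b)).
by rewrite (eqP (valP b)) card_ord leqNgt ni.
Qed.

Lemma rees_tor_stable :
  exists2 D, (0 < D)%N & forall d i j, (D < d)%N -> nz i j d <-> nz i j D.
Proof.
have Ii d : is_ideal (Ipow d) by apply: ideal_exp_ideal; exact: ideal_gen_ideal.
have /fin_all_exists[D stab] := fun i : 'I_n.+1 => rees_tor_stable_index i.
exists (\max_i D i).+1 => // d i j lt; have [ni|ni] := ltnP n i.
  by split=> h; case: (koszul_tor0 (Ii _) ni h).
have Di : (D (Ordinal (ni : i < n.+1)%N) <= \max_i D i)%N by exact: leq_bigmax.
have st d' := stab (Ordinal (ni : i < n.+1)%N) d' j.
rewrite (st d); last exact: leq_trans Di (ltnW (ltnW lt)).
by rewrite (st (\max_i D i).+1) // ltnW.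
Qed.

End ReesTorStable.

Theorem theorem1p3 (K : fieldType) (n r k : nat)
    (f : 'I_k.+1 -> {mpoly K[n]}) (hf : forall l, f l \is r.-homog) :
  exists2 D : nat, (0 < D)%N &
    forall d : nat, (D < d)%N -> forall (i : nat) (j : int),
      betti (ideal_exp (ideal_gen f) d) i (j + (r * d)%N%:Z) <> 0%N <->
      betti (ideal_exp (ideal_gen f) D) i (j + (r * D)%N%:Z) <> 0%N.
Proof.
have Ii d : is_ideal (ideal_exp (ideal_gen f) d).
  by apply: ideal_exp_ideal; exact: ideal_gen_ideal.
have [D D0 stab] := rees_tor_stable hf; exists D => // d Dd i j.
by rewrite !betti_neq0 //; exact: stab.
Qed.
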